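(* Let $a,b\in\mathbb C$ with $a\neq 0$ and $|b|=1+\delta$ for some $\delta>0$, and let $H:\mathbb C^3\to\mathbb C^3$ be the polynomial automorphism $H(x,y,z)=(xy+az,\;x^2+by,\;x)$. For $R>0$ let $$V^{+}=\{(x,y,z)\in \mathbb C^{3}: |z|>\max\{R,\,|x|,\,(1+\delta)|y|^{1/2}\}\},\qquad U^-=\bigcup_{n=0}^{\infty}H^{n}(V^+),\qquad K^-=\mathbb C^3\setminus U^-.$$ Then: (i) There exist $R_0>1$ and constants $C_1,C_2>0$ depending on $\delta$ (for the given map $H$) such that for all $R>R_0$ we have $H^{-1}(V^+)\subset V^+$, and if $w=(x,y,z)\in V^+$ and $H^{-1}(w)=(x_1,y_1,z_1)$, then $$C_1|z|^3<|z_1|<C_2|z|^3.$$ (ii) For $R$ sufficiently large, the sequence $(\|H^{-n}(w)\|)_{n\ge 0}$ is bounded for every $w\in K^-$.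
   Context: The inverse of $H$ is $$H^{-1}(x,y,z)=\left(z,\ \frac{y-z^2}{b},\ \frac1a\left(x-z\,\frac{y-z^2}{b}\right)\right).$$ $H^{-n}$ denotes the $n$-th iterate of $H^{-1}$, $H^{n}$ the $n$-th iterate of $H$, and $\|\cdot\|$ is the Euclidean norm on $\mathbb C^3$. The constants $a,b,\delta$ are fixed; the constant $R$ in the definition of $V^+$ is taken sufficiently large throughout. *)

(* Defs.v *)
From Stdlib Require Import Reals Lra.
From Coquelicot Require Import Coquelicot.
Open Scope R_scope.

Definition C3 : Type := (C * C * C)%type.

Definition norm3 (w : C3) : R :=
  let '(x, y, z) := w in sqrt (Cmod x ^ 2 + Cmod y ^ 2 + Cmod z ^ 2).

Definition H (a b : C) (w : C3) : C3 :=
  let '(x, y, z) := w in ((x * y + a * z)%C, (x * x + b * y)%C, x).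

Definition Hinv (a b : C) (w : C3) : C3 :=
  let '(x, y, z) := w in
  (z, ((y - z * z) / b)%C, (/ a * (x - z * ((y - z * z) / b)))%C).

Lemma Hinv_H (a b : C) (w : C3) :
  a <> RtoC 0 -> b <> RtoC 0 -> Hinv a b (H a b w) = w.
Proof.
intros Ha Hb; destruct w as [[x y] z]; unfold Hinv, H.
repeat apply f_equal2; trivial; field; auto.
Qed.

Lemma H_Hinv (a b : C) (w : C3) :
  a <> RtoC 0 -> b <> RtoC 0 -> H a b (Hinv a b w) = w.
Proof.
intros Ha Hb; destruct w as [[x y] z]; unfold Hinv, H.
repeat apply f_equal2; trivial; field; auto.
Qed.

Definition Vplus (delta r : R) (w : C3) : Prop :=
  let '(x, y, z) := w in
  Cmod z > Rmax r (Rmax (Cmod x) ((1 + delta) * sqrt (Cmod y))).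

Definition Uminus (a b : C) (delta r : R) (w : C3) : Prop :=
  exists (n : nat) (v : C3), Vplus delta r v /\ w = Nat.iter n (H a b) v.

Definition Kminus (a b : C) (delta r : R) (w : C3) : Prop :=
  ~ Uminus a b delta r w.

(* Main.v *)
Require Import Defs.
From Stdlib Require Import Reals Lra.
From Coquelicot Require Import Coquelicot.
Open Scope R_scope.

(** Write [(x1, y1, z1) = H^-1 (x, y, z)], so that [b y1 = y - z^2] and
    [a z1 = x - z y1].  On [V+] the term [z^2] dominates [y] and [z y1]
    dominates [x], which gives (i).

    For (ii), the backward orbit of a point of [K-] never meets [V+].  The
    region [|x|^2 <= L], [|b| |y| <= L] is then preserved along the orbit for
    every large [L].  If [|y1| <= S], then [|x1|^2 = |z|^2 <= |y| + |b| S],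
    which is at most [L] because [|y| <= L / |b|].  If [|y1| > S], then
    [|z1| <= max (r, |z|, |b| |y1|^(1/2))] together with [z y1 = x - a z1]
    forces [|z|^2] to be a small multiple of [L], and
    [|b| |y1| <= |y| + |z|^2 <= L]. *)

Lemma Cmod_sub_le (u v w : C) :
  u = (v - w)%C -> Cmod u <= Cmod v + Cmod w /\ Cmod w <= Cmod v + Cmod u.
Proof.
intros E; split.
- rewrite E, <- (Cmod_opp w); apply Cmod_triangle.
- replace w with (v + - u)%C by (rewrite E; ring).
  rewrite <- (Cmod_opp u); apply Cmod_triangle.
Qed.

(** The triangle inequality, in both directions, for [b y1 = y - z^2] and [a z1 = x - z y1]. The
    later estimates are real arithmetic on these moduli. *)
Lemma Hinv_moduli (a b x y z x1 y1 z1 : C) :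
  a <> RtoC 0 -> b <> RtoC 0 -> Hinv a b (x, y, z) = (x1, y1, z1) ->
  x1 = z /\
  Cmod b * Cmod y1 <= Cmod y + Cmod z ^ 2 /\
  Cmod z ^ 2 <= Cmod y + Cmod b * Cmod y1 /\
  Cmod a * Cmod z1 <= Cmod x + Cmod z * Cmod y1 /\
  Cmod z * Cmod y1 <= Cmod x + Cmod a * Cmod z1.
Proof.
intros Ha Hb E; injection E as <- Ey Ez.
assert (Fy : (b * y1)%C = (y - z * z)%C) by (rewrite <- Ey; field; auto).
assert (Fz : (a * z1)%C = (x - z * y1)%C)
  by (rewrite <- Ez, <- Ey; field; auto).
apply Cmod_sub_le in Fy; apply Cmod_sub_le in Fz.
rewrite !Cmod_mult in Fy, Fz.
replace (Cmod z ^ 2) with (Cmod z * Cmod z) by ring.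
tauto.
Qed.

Lemma Vplus_iff (delta r : R) (x y z : C) :
  Vplus delta r (x, y, z) <->
  r < Cmod z /\ Cmod x < Cmod z /\ (1 + delta) * sqrt (Cmod y) < Cmod z.
Proof.
unfold Vplus, Rgt; rewrite !Rmax_Rlt; tauto.
Qed.

(* Here [A = |a|], [B = |b|], and [c = (1 - 1 / B^2) / B] is the lower bound of
   [|y1| / |z|^2] on [V+]. *)
Lemma cubic_growth (A B c X Y Z Y1 Z1 : R) :
  1 < B -> c * B ^ 3 = B ^ 2 - 1 -> 0 <= X -> 0 <= Y -> 0 <= Y1 ->
  1 < Z -> 2 < c * Z -> X < Z -> B ^ 2 * Y < Z ^ 2 ->
  B * Y1 <= Y + Z ^ 2 -> Z ^ 2 <= Y + B * Y1 ->
  A * Z1 <= X + Z * Y1 -> Z * Y1 <= X + A * Z1 ->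
  Y1 <= 2 * Z ^ 2 /\ c / 4 * Z ^ 3 < A * Z1 < 4 * Z ^ 3.
Proof.
intros HB Hc HX HY HY1 HZ HcZ HXZ HYZ I1 I2 I3 I4.
assert (HB2 : 1 < B ^ 2) by nra.
assert (HYZ' : Y <= Z ^ 2) by nra.
assert (U : Y1 <= 2 * Z ^ 2) by nra.
assert (L : c * Z ^ 2 <= Y1).
{ assert (P : 0 < B ^ 3) by (apply pow_lt; lra).
  apply Rmult_le_reg_r with (B ^ 3); [exact P|].
  replace (c * Z ^ 2 * B ^ 3) with (c * B ^ 3 * Z ^ 2) by ring.
  rewrite Hc.
  apply Rmult_le_compat_l with (r := B ^ 2) in I2; nra. }
assert (Q : Z < Z ^ 2) by nra.
assert (Q3 : Z ^ 2 < Z ^ 3) by nra.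
(* Hence [X < Z^2 < c / 2 * Z^3], so subtracting [X] from [Z * Y1] costs at most half of
   [c * Z^3]. *)
assert (c3 : 2 * Z ^ 2 < c * Z ^ 3) by nra.
assert (ZL : c * Z ^ 3 <= Z * Y1) by nra.
assert (ZU : Z * Y1 <= 2 * Z ^ 3) by nra.
repeat split; lra.
Qed.

Lemma Vplus_Hinv (a b : C) (delta : R) :
  a <> RtoC 0 -> 0 < delta -> Cmod b = 1 + delta ->
  exists r0 C1 C2 : R, 1 < r0 /\ 0 < C1 /\ 0 < C2 /\
    forall (r : R) (x y z x1 y1 z1 : C), r0 < r ->
      Vplus delta r (x, y, z) -> Hinv a b (x, y, z) = (x1, y1, z1) ->
      Vplus delta r (x1, y1, z1) /\
      C1 * Cmod z ^ 3 < Cmod z1 < C2 * Cmod z ^ 3.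
Proof.
intros Ha Hd Hb.
assert (HA : 0 < Cmod a) by (apply Cmod_gt_0; exact Ha).
assert (Hb0 : b <> RtoC 0) by (apply Cmod_gt_0; lra).
set (B := 1 + delta) in *; assert (HB : 1 < B) by (unfold B; lra).
set (c := (B ^ 2 - 1) / B ^ 3).
assert (Hc : c * B ^ 3 = B ^ 2 - 1) by (unfold c; field; lra).
assert (Hc0 : 0 < c) by (apply Rdiv_lt_0_compat; [nra|apply pow_lt; lra]).
set (C1 := c / 4 / Cmod a); set (C2 := 4 / Cmod a).
assert (HC1 : 0 < C1) by (apply Rdiv_lt_0_compat; lra).
assert (HC2 : 0 < C2) by (apply Rdiv_lt_0_compat; lra).
assert (P1 : 0 < 2 / c) by (apply Rdiv_lt_0_compat; lra).
assert (P2 : 0 < 2 * B / C1) by (apply Rdiv_lt_0_compat; lra).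
(* The summands give [1 < |z|] and [2 < c |z|] for [cubic_growth], and [2 B < C1 |z|] for the
   invariance of [V+]. *)
exists (1 + 2 / c + 2 * B / C1), C1, C2.
split; [lra|]; split; [exact HC1|]; split; [exact HC2|].
intros r x y z x1 y1 z1 Hr HV E.
apply Vplus_iff in HV; fold B in HV; destruct HV as (Vr & Vx & Vy).
destruct (Hinv_moduli a b x y z x1 y1 z1 Ha Hb0 E) as (-> & I1 & I2 & I3 & I4).
rewrite Hb in I1, I2.
pose proof (Cmod_ge_0 x); pose proof (Cmod_ge_0 y); pose proof (Cmod_ge_0 y1).
assert (HYZ : B ^ 2 * Cmod y < Cmod z ^ 2).
{ rewrite <- (pow2_sqrt (Cmod y)) by assumption.
  assert (0 <= B * sqrt (Cmod y)) by (apply Rmult_le_pos; [lra|apply sqrt_pos]).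
  nra. }
assert (HcZ : 2 < c * Cmod z).
{ replace 2 with (c * (2 / c)) by (field; lra).
  apply Rmult_lt_compat_l; lra. }
assert (HCZ : 2 * B < C1 * Cmod z).
{ replace (2 * B) with (C1 * (2 * B / C1)) by (field; lra).
  apply Rmult_lt_compat_l; lra. }
destruct (cubic_growth (Cmod a) B c (Cmod x) (Cmod y) (Cmod z) (Cmod y1)
  (Cmod z1)) as (G1 & G2 & G3); try assumption; try lra.
assert (F1 : C1 * Cmod z ^ 3 < Cmod z1).
{ apply Rmult_lt_reg_l with (Cmod a); [exact HA|].
  replace (Cmod a * (C1 * Cmod z ^ 3)) with (c / 4 * Cmod z ^ 3); [exact G2|].
  unfold C1; field; lra. }
assert (F2 : Cmod z1 < C2 * Cmod z ^ 3).
{ apply Rmult_lt_reg_l with (Cmod a); [exact HA|].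
  replace (Cmod a * (C2 * Cmod z ^ 3)) with (4 * Cmod z ^ 3); [exact G3|].
  unfold C2; field; lra. }
assert (HZ : 1 < Cmod z) by lra.
(* This one bound yields all three conditions of [V+], because [|x1| = |z|], [r < |z|] and
   [|y1|^(1/2) <= 2 |z|]. *)
assert (F : 2 * B * Cmod z < Cmod z1).
{ apply Rlt_trans with (2 := F1).
  assert (Cmod z < Cmod z ^ 2) by nra.
  apply Rlt_trans with (C1 * Cmod z * Cmod z); nra. }
split; [|split; assumption].
apply Vplus_iff; fold B.
assert (S1 : sqrt (Cmod y1) <= 2 * Cmod z).
{ rewrite <- (sqrt_pow2 (2 * Cmod z)) by lra.
  apply sqrt_le_1_alt; nra. }
repeat split; nra.
Qed.

(** Used with [q = |y1|^(1/2)]. Off [V+], [Z1] grows at most linearly in [q], while [Z * q^2] is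
    quadratic in [q]; dividing by [q] makes [Z] of order [(X + A * (r + B)) / Q]. *)
Lemma sq_contraction (A B Q r X Z Z1 q : R) :
  0 < A -> 0 < B -> 0 < r -> 2 * A + 1 <= Q -> Q < q -> 0 <= X -> 0 <= Z ->
  Z1 <= r \/ Z1 <= Z \/ Z1 <= B * q ->
  Z * q ^ 2 <= X + A * Z1 ->
  Q ^ 2 * Z ^ 2 <= 8 * (X ^ 2 + (A * (r + B)) ^ 2).
Proof.
intros HA HB Hr HQ Hq HX HZ HZ1 I.
assert (M : Z1 <= r + Z + B * q) by (destruct HZ1 as [|[|]]; nra).
assert (I' : Z * q ^ 2 <= X + A * (r + Z + B * q)) by nra.
assert (Hq2 : q < q ^ 2) by nra.
(* Since [2 * A < q^2], half of [Z * q^2] absorbs the term [A * Z] on the right. *)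
assert (J : Z * (q ^ 2 / 2) <= Z * (q ^ 2 - A))
  by (apply Rmult_le_compat_l; lra).
assert (N : q * (Z * q) <= q * (2 * (X + A * (r + B)))).
{ assert (0 <= A * r) by nra.
  assert (0 <= (q - 1) * X) by (apply Rmult_le_pos; lra).
  assert (0 <= (q - 1) * (A * r)) by (apply Rmult_le_pos; lra).
  nra. }
apply Rmult_le_reg_l in N; [|lra].
assert (N' : Q * Z <= 2 * (X + A * (r + B))) by nra.
assert (W : 0 <= A * (r + B)) by nra.
replace (Q ^ 2 * Z ^ 2) with ((Q * Z) ^ 2) by ring.
apply Rle_trans with ((2 * (X + A * (r + B))) ^ 2).
- apply pow_incr; nra.
- pose proof (pow2_ge_0 (X - A * (r + B))); nra.
Qed.

(** [K] is chosen before the point, so one [L] can serve a whole orbit. The cases are split at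
    [|y1| = Q^2]. *)
Lemma absorbing_region (a b : C) (delta r : R) :
  a <> RtoC 0 -> 0 < delta -> Cmod b = 1 + delta -> 0 < r ->
  exists K : R, forall (L : R) (x y z x1 y1 z1 : C), K <= L ->
    Hinv a b (x, y, z) = (x1, y1, z1) -> ~ Vplus delta r (x1, y1, z1) ->
    Cmod x ^ 2 <= L -> Cmod b * Cmod y <= L ->
    Cmod x1 ^ 2 <= L /\ Cmod b * Cmod y1 <= L.
Proof.
intros Ha Hd Hb Hr.
assert (HA : 0 < Cmod a) by (apply Cmod_gt_0; exact Ha).
assert (Hb0 : b <> RtoC 0) by (apply Cmod_gt_0; lra).
set (B := 1 + delta) in *; assert (HB : 1 < B) by (unfold B; lra).
assert (P : 0 < 16 * B / (B - 1)) by (apply Rdiv_lt_0_compat; lra).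
(* [2 |a| + 1] is what [sq_contraction] asks for; the last summand makes [16 B / Q^2] at most
   [B - 1]. *)
set (Q := 2 * Cmod a + 1 + 16 * B / (B - 1)).
assert (HQ : 16 * B <= (B - 1) * Q ^ 2).
{ assert (E : 16 * B = (B - 1) * (16 * B / (B - 1))) by (field; lra).
  rewrite E at 1; apply Rmult_le_compat_l; unfold Q; nra. }
set (D := (Cmod a * (r + B)) ^ 2).
(* [T <= L] is equivalent to [L / B + B * Q^2 <= L], the bound on [|z|^2] when [|y1| <= Q^2]. *)
set (T := B ^ 2 * Q ^ 2 / (B - 1)).
assert (HT : (B - 1) * T = B ^ 2 * Q ^ 2) by (unfold T; field; lra).
assert (D0 : 0 <= D) by apply pow2_ge_0.
assert (Q0 : 1 < Q) by (unfold Q; lra).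
assert (T0 : 0 <= T) by (apply Rle_mult_inv_pos; nra).
exists (D + T).
intros L x y z x1 y1 z1 HL E NV Lx Ly.
destruct (Hinv_moduli a b x y z x1 y1 z1 Ha Hb0 E) as (-> & I1 & I2 & I3 & I4).
rewrite Hb in *.
pose proof (Cmod_ge_0 x); pose proof (Cmod_ge_0 y); pose proof (Cmod_ge_0 y1).
pose proof (Cmod_ge_0 z).
assert (LT : B ^ 2 * Q ^ 2 <= (B - 1) * L) by (rewrite <- HT; nra).
destruct (Rle_or_lt (Cmod y1) (Q ^ 2)) as [S|S].
- split.
  + apply Rmult_le_reg_l with B; [lra|].
    assert (B * (B * Cmod y1) <= B * (B * Q ^ 2))
      by (do 2 (apply Rmult_le_compat_l; [lra|]); exact S).
    nra.
  + assert (B * Q ^ 2 <= T).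
    { apply Rmult_le_reg_l with (B - 1); [lra|]. rewrite HT.
      assert (0 <= B * Q ^ 2) by nra. nra. }
    nra.
- assert (Hq : Q < sqrt (Cmod y1)).
  { rewrite <- (sqrt_pow2 Q) by lra. apply sqrt_lt_1_alt; nra. }
  assert (G : Q ^ 2 * Cmod z ^ 2 <= 8 * (Cmod x ^ 2 + D)).
  { apply (sq_contraction (Cmod a) B Q r (Cmod x) (Cmod z) (Cmod z1)
      (sqrt (Cmod y1))); try assumption; try lra.
    - unfold Q; lra.
    - rewrite Vplus_iff in NV; fold B in NV.
      destruct (Rle_or_lt (Cmod z1) r); [tauto|].
      destruct (Rle_or_lt (Cmod z1) (Cmod z)); [tauto|].
      destruct (Rle_or_lt (Cmod z1) (B * sqrt (Cmod y1))); tauto.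
    - rewrite pow2_sqrt; assumption. }
  (* [G] is at most [16 L], so [|z|^2 <= (1 - 1 / B) L]; adding [|y| <= L / B] gives exactly [L]. *)
  assert (G' : Q ^ 2 * (B * Cmod z ^ 2) <= Q ^ 2 * ((B - 1) * L)).
  { assert (L0 : 0 <= L) by lra.
    apply Rle_trans with (16 * B * L); nra. }
  apply Rmult_le_reg_l in G'; [|nra].
  split; apply Rmult_le_reg_l with B; nra.
Qed.

Lemma iter_H_Hinv (a b : C) (n : nat) (w : C3) :
  a <> RtoC 0 -> b <> RtoC 0 ->
  Nat.iter n (H a b) (Nat.iter n (Hinv a b) w) = w.
Proof.
intros Ha Hb; induction n as [|n IH]; [reflexivity|].
rewrite Nat.iter_succ_r; simpl; rewrite H_Hinv by assumption; exact IH.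
Qed.

Lemma Kminus_iter_Hinv (a b : C) (delta r : R) (n : nat) (w : C3) :
  a <> RtoC 0 -> b <> RtoC 0 ->
  Kminus a b delta r w -> ~ Vplus delta r (Nat.iter n (Hinv a b) w).
Proof.
intros Ha Hb HK HV; apply HK.
exists n, (Nat.iter n (Hinv a b) w); split; [exact HV|].
symmetry; apply iter_H_Hinv; assumption.
Qed.

Lemma Kminus_bounded (a b : C) (delta r : R) (w : C3) :
  a <> RtoC 0 -> 0 < delta -> Cmod b = 1 + delta -> 0 < r ->
  Kminus a b delta r w ->
  exists M : R, forall n : nat, norm3 (Nat.iter n (Hinv a b) w) <= M.
Proof.
intros Ha Hd Hb Hr HK.
assert (Hb0 : b <> RtoC 0) by (apply Cmod_gt_0; lra).
destruct (absorbing_region a b delta r Ha Hd Hb Hr) as [K HKL].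
assert (B : exists L, forall n x y z, Nat.iter n (Hinv a b) w = (x, y, z) ->
  Cmod x ^ 2 <= L /\ Cmod b * Cmod y <= L).
{ destruct w as [[x0 y0] z0].
  (* Large enough for [absorbing_region] and for the starting point to lie in the region. *)
  exists (Rmax K (Rmax (Cmod x0 ^ 2) (Cmod b * Cmod y0))).
  induction n as [|n IH]; intros x y z E.
  - injection E as <- <- <-.
    split; (eapply Rle_trans; [|apply Rmax_r]); [apply Rmax_l|apply Rmax_r].
  - pose proof (Kminus_iter_Hinv a b delta r (S n) _ Ha Hb0 HK) as NV.
    rewrite E in NV; simpl in E.
    destruct (Nat.iter n (Hinv a b) (x0, y0, z0)) as [[x' y'] z'].
    destruct (IH x' y' z' eq_refl).
    apply (HKL _ x' y' z' x y z); try assumption; apply Rmax_l. }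
destruct B as [L HL].
(* The last [L] bounds [|z|^2]: [z] is the first coordinate of the next iterate, hence the appeal to
   [S n]. *)
exists (sqrt (L + L ^ 2 + L)); intros n.
pose proof (HL (S n)) as HS; simpl in HS; specialize (HL n).
destruct (Nat.iter n (Hinv a b) w) as [[x y] z].
destruct (HL x y z eq_refl) as [Lx Ly].
destruct (HS _ _ _ eq_refl) as [Lz _].
unfold norm3; apply sqrt_le_1_alt.
pose proof (Cmod_ge_0 y).
assert (Cmod y <= L) by nra.
assert (Cmod y ^ 2 <= L ^ 2) by (apply pow_incr; lra).
simpl in *; lra.
Qed.

Theorem proposition2p1 (a b : C) (delta : R)
  (ha : a <> RtoC 0) (hdelta : 0 < delta) (hb : Cmod b = 1 + delta) :
  (exists r0 C1 C2 : R, 1 < r0 /\ 0 < C1 /\ 0 < C2 /\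
     forall r : R, r0 < r ->
       (forall w : C3, Vplus delta r w -> Vplus delta r (Hinv a b w)) /\
       (forall x y z x1 y1 z1 : C,
          Vplus delta r (x, y, z) ->
          Hinv a b (x, y, z) = (x1, y1, z1) ->
          C1 * Cmod z ^ 3 < Cmod z1 < C2 * Cmod z ^ 3))
  /\
  (exists r0 : R, 0 < r0 /\
     forall r : R, r0 < r ->
       forall w : C3, Kminus a b delta r w ->
         exists M : R, forall n : nat, norm3 (Nat.iter n (Hinv a b) w) <= M).
Proof.
split.
- destruct (Vplus_Hinv a b delta ha hdelta hb)
    as (r0 & C1 & C2 & Hr0 & HC1 & HC2 & HV).
  exists r0, C1, C2; repeat (split; [assumption|]).
  intros r Hr; split.
  + intros [[x y] z] Hw.
    exact (proj1 (HV r x y z _ _ _ Hr Hw eq_refl)).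
  + intros x y z x1 y1 z1 Hw E.
    exact (proj2 (HV r x y z x1 y1 z1 Hr Hw E)).
- exists 1; split; [lra|]; intros r Hr w HK.
  apply (Kminus_bounded a b delta r w ha hdelta hb); [lra|exact HK].
Qed.
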